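(* Let $A$ be a commutative Banach algebra. Then $A$ is weakly amenable if and only if $A$ is cyclically weakly amenable.
   Context: Let $A$ be a complex Banach algebra with dual $A^*$. For $F\in A^*$ and $a,b\in A$ put $\langle F\cdot a,b\rangle=\langle F,ab\rangle$ and $\langle a\cdot F,b\rangle=\langle F,ba\rangle$. A linear operator $D:A\to A^*$ is a derivation if $D(ab)=D(a)\cdot b+a\cdot D(b)$ for all $a,b\in A$. It is inner if there is $F\in A^*$ with $D(a)=F\cdot a-a\cdot F$ for all $a\in A$. It is cyclic if $\langle D(a),b\rangle+\langle D(b),a\rangle=0$ for all $a,b\in A$. $A$ is weakly amenable if every continuous derivation from $A$ into $A^*$ is inner, and cyclically weakly amenable if every continuous derivation from $A$ into $A^*$ is cyclic. *)

(* Defs.v *)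
From HB Require Import structures.
From mathcomp Require Import all_boot all_order all_algebra.
From mathcomp.real_closed Require Export complex.
From mathcomp Require Import all_classical all_reals all_analysis.

Set Implicit Arguments.
Unset Strict Implicit.
Unset Printing Implicit Defensive.

Import Order.TTheory GRing.Theory Num.Theory.
Import numFieldNormedType.Exports.
Import Normc.

Local Open Scope classical_set_scope.
Local Open Scope ring_scope.

(* Banach algebras need not have a unit, so they are not based on MathComp's
   rings: the product is a semigroup law, written [(a * b)%g]. *)
HB.mixin Record CompleteNormedModule_isBanachAlgebra (K : numFieldType) A
    of CompleteNormedModule K A & Semigroup A := {
  banach_mulDl : forall a b c : A,
    ((a + b)%R * c)%g = (a * c)%g + (b * c)%g ;
  banach_mulDr : forall a b c : A,
    (a * (b + c)%R)%g = (a * b)%g + (a * c)%g ;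
  banach_scaleAl : forall (k : K) (a b : A),
    ((k *: a)%R * b)%g = k *: (a * b)%g ;
  banach_scaleAr : forall (k : K) (a b : A),
    (a * (k *: b)%R)%g = k *: (a * b)%g ;
  banach_normM : forall a b : A, `|(a * b)%g| <= `|a| * `|b|
}.

#[short(type="banachAlgType")]
HB.structure Definition BanachAlgebra (K : numFieldType) :=
  {A of CompleteNormedModule K A & Semigroup A
      & CompleteNormedModule_isBanachAlgebra K A}.

Section Dual.
Context {R : realType} {V : normedModType R[i]}.

Definition dual_pred : {pred V -> R[i]^o} :=
  fun f => `[< linear f /\ continuous f >].

Lemma dual_pred_submod : submod_closed dual_pred.
Proof.
split.
  apply/asboolP; split; last by move=> x; exact: cvg_cst.
  move=> k x y; rewrite -[RHS]/(k *: (0 : R[i]^o) + 0).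
  by rewrite scaler0 addr0.
move=> k f g /asboolP[lf cf] /asboolP[lg cg]; apply/asboolP; split.
  move=> c x y.
  rewrite -[LHS]/(k *: f (c *: x + y) + g (c *: x + y)).
  rewrite -[RHS]/(c *: (k *: f x + g x) + (k *: f y + g y)).
  by rewrite lf lg !scalerDr !scalerA (mulrC k c) addrACA.
move=> x; apply: (@cvgD _ R[i]^o); last exact: cg.
by apply: cvgZr; exact: cf.
Qed.

HB.instance Definition _ :=
  GRing.isSubmodClosed.Build R[i] (V -> R[i]^o) dual_pred dual_pred_submod.

End Dual.

(* The topological dual of [V], as a submodule of the functions [V -> R[i]]. *)
Record dual (R : realType) (V : normedModType R[i]) := Dual {
  dual_fun :> V -> R[i]^o ;
  dual_funP : dual_fun \in dual_pred
}.
Arguments Dual {R V}.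

Section DualNorm.
Context {R : realType} {V : normedModType R[i]}.
Implicit Types F G : dual V.

HB.instance Definition _ := [isSub for @dual_fun R V].
HB.instance Definition _ := [Choice of dual V by <:].
HB.instance Definition _ := [SubChoice_isSubLmodule of dual V by <:].

Lemma dual_linear F : linear F.
Proof. by have /asboolP[] := dual_funP F. Qed.

HB.instance Definition _ F :=
  GRing.isLinear.Build R[i] V R[i]^o _ (dual_fun F) (dual_linear F).

Lemma dual_continuous F : continuous F.
Proof. by have /asboolP[] := dual_funP F. Qed.

Lemma dualP F G : F =1 G -> F = G.
Proof. by move=> FG; apply/val_inj/funext. Qed.

Lemma dualDE F G x : (F + G) x = F x + G x. Proof. by []. Qed.
Lemma dualBE F G x : (F - G) x = F x - G x. Proof. by []. Qed.
Lemma dualZE k F x : (k *: F) x = k *: F x. Proof. by []. Qed.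

Definition dual_norm F : R :=
  sup [set normc (F x) | x in [set x : V | `|x| <= 1]].

Lemma complex_normE (z : R[i]) : `|z| = (normc z)%:C%C.
Proof. by []. Qed.

Lemma complex_norm_Re (W : normedModType R[i]) (x : W) :
  `|x| = (complex.Re `|x|)%:C%C.
Proof. by rewrite RRe_real // ger0_real. Qed.

Lemma dual_norm_has_sup F :
  has_sup [set normc (F x) | x in [set x : V | `|x| <= 1]].
Proof.
split; first by exists (normc (F 0)), 0 => //=; rewrite normr0 ler01.
have /linear_bounded_continuous/bounded_funP/(_ 1)[M FM] :=
  @dual_continuous F.
exists (complex.Re M) => _ [x /= x1 <-].
have := FM x x1; rewrite [X in X <= _]complex_normE lecE => /andP[_].
by [].
Qed.

Lemma dual_norm_ub F x : `|x| <= 1 -> normc (F x) <= dual_norm F.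
Proof.
move=> x1; apply: sup_upper_bound; first exact: dual_norm_has_sup.
by exists x.
Qed.

Lemma dual_norm_le F r :
  (forall x, `|x| <= 1 -> normc (F x) <= r) -> dual_norm F <= r.
Proof.
move=> Fr; apply: ge_sup; first by case: (dual_norm_has_sup F).
by move=> _ [x /= x1 <-]; exact: Fr.
Qed.

Lemma dual_norm_ge0 F : 0 <= dual_norm F.
Proof.
apply: le_trans (@dual_norm_ub F 0 _); last by rewrite normr0 ler01.
by rewrite linear0 normc0.
Qed.

Lemma dual_normD F G :
  (dual_norm (F + G))%:C%C <= (dual_norm F)%:C%C + (dual_norm G)%:C%C.
Proof.
rewrite -rmorphD lecR; apply: dual_norm_le => x x1; rewrite dualDE.
by rewrite (le_trans (le_normcD _ _))// lerD// dual_norm_ub.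
Qed.

Lemma dual_normZ_le k F : dual_norm (k *: F) <= normc k * dual_norm F.
Proof.
apply: dual_norm_le => x x1; rewrite dualZE normcM.
apply: ler_wpM2l; last exact: dual_norm_ub.
by rewrite -ler0c -complex_normE.
Qed.

Lemma dual_normZ k F :
  (dual_norm (k *: F))%:C%C = `|k| * (dual_norm F)%:C%C.
Proof.
rewrite complex_normE -rmorphM; congr (_%:C)%C.
apply/eqP; rewrite eq_le dual_normZ_le /=.
have [->|k0] := eqVneq k 0; first by rewrite normc0 mul0r dual_norm_ge0.
have nk0 : 0 < normc k by rewrite -ltcR -complex_normE normr_gt0.
rewrite -ler_pdivlMl// -normcV.
by rewrite -[F in X in X <= _](scalerK k0) dual_normZ_le.
Qed.

Lemma dual_norm0_eq0 F : (dual_norm F)%:C%C = 0 -> F = 0.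
Proof.
move=> /complexI F0; apply: dualP => x.
have [->|x0] := eqVneq x 0; first by rewrite linear0.
have := @dual_norm_ub F (`|x|^-1 *: x) _.
rewrite F0 normrZ normfV normr_id mulVf ?normr_eq0// => /(_ (lexx _)).
rewrite linearZ normcM => xF.
have nx : `|x|^-1 != 0 by rewrite invr_eq0 normr_eq0.
have : normc (`|x|^-1 * F x) = 0.
  apply/eqP; rewrite eq_le normcM xF /=.
  by rewrite -normcM -ler0c -complex_normE.
by move=> /eq0_normc/eqP; rewrite mulf_eq0 (negbTE nx) /= => /eqP.
Qed.

HB.instance Definition _ := Lmodule_isNormed.Build R[i] (dual V)
  dual_normD dual_normZ dual_norm0_eq0.

End DualNorm.

Section WeakAmenability.
Context {R : realType} {A : banachAlgType R[i]}.
Implicit Types (F : dual A) (a b : A) (D : {linear A -> dual A}).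

Lemma dual_ract_subproof F a : (fun x : A => F (a * x)%g) \in dual_pred.
Proof.
have lF : linear (fun x : A => F (a * x)%g).
  by move=> k x y; rewrite banach_mulDr banach_scaleAr linearP.
apply/asboolP; split => // x.
have ax : continuous (fun x : A => (a * x)%g).
  have la : linear (fun x : A => (a * x)%g).
    by move=> k y z; rewrite banach_mulDr banach_scaleAr.
  pose La := HB.pack_for {linear A -> A} (fun x : A => (a * x)%g)
    (GRing.isLinear.Build R[i] A A _ _ la).
  apply: (@bounded_linear_continuous _ _ _ La); apply/bounded_funP => r.
  exists (`|a| * r) => y yr.
  by rewrite (le_trans (banach_normM _ _))// ler_wpM2l.
by apply: (@continuous_comp _ _ _ (fun x : A => (a * x)%g) F);
  [exact: ax|exact: dual_continuous].
Qed.

Lemma dual_lact_subproof a F : (fun x : A => F (x * a)%g) \in dual_pred.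
Proof.
have lF : linear (fun x : A => F (x * a)%g).
  by move=> k x y; rewrite banach_mulDl banach_scaleAl linearP.
apply/asboolP; split => // x.
have xa : continuous (fun x : A => (x * a)%g).
  have la : linear (fun x : A => (x * a)%g).
    by move=> k y z; rewrite banach_mulDl banach_scaleAl.
  pose La := HB.pack_for {linear A -> A} (fun x : A => (x * a)%g)
    (GRing.isLinear.Build R[i] A A _ _ la).
  apply: (@bounded_linear_continuous _ _ _ La); apply/bounded_funP => r.
  exists (r * `|a|) => y yr.
  by rewrite (le_trans (banach_normM _ _))// ler_wpM2r.
by apply: (@continuous_comp _ _ _ (fun x : A => (x * a)%g) F);
  [exact: xa|exact: dual_continuous].
Qed.

(* [F . a], with <F . a, x> = <F, a x> *)
Definition dual_ract F a : dual A := Dual _ (dual_ract_subproof F a).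
(* [a . F], with <a . F, x> = <F, x a> *)
Definition dual_lact a F : dual A := Dual _ (dual_lact_subproof a F).

Definition derivation D :=
  forall a b, D (a * b)%g = dual_ract (D a) b + dual_lact a (D b).

Definition inner D :=
  exists F, forall a, D a = dual_ract F a - dual_lact a F.

Definition cyclic_operator D := forall a b, D a b + D b a = 0.

End WeakAmenability.

Definition weakly_amenable (R : realType) (A : banachAlgType R[i]) :=
  forall D : {linear A -> dual A}, continuous D -> derivation D -> inner D.

Definition cyclically_weakly_amenable (R : realType) (A : banachAlgType R[i]) :=
  forall D : {linear A -> dual A},
    continuous D -> derivation D -> cyclic_operator D.

(* Main.v *)
Require Import Defs.
From HB Require Import structures.
From mathcomp Require Import all_boot all_order all_algebra.
From mathcomp.real_closed Require Import complex.
From mathcomp Require Import all_classical all_reals all_analysis.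

(** Over a commutative algebra the two module actions on the dual coincide, so
    the only inner derivation is zero ([inner_eq0]). Hence weak amenability
    means that every continuous derivation vanishes, and it trivially implies
    cyclic weak amenability.

    Conversely, suppose that every continuous derivation is cyclic, and let [D]
    be one of them. For each [c] the operator [c . D] is again a continuous
    derivation, and its cyclicity reads [<D a, b c> + <D b, a c> = 0], which is
    [<D (a b), c> = 0] by the Leibniz rule: [D] vanishes on products
    ([derivation_mul_eq0]). As [D] itself is cyclic, each functional [F = D a]
    then also vanishes on products. Such an [F] yields the rank-one operator
    [x |-> F x *: F], a derivation because both sides of the Leibniz rule are
    zero. It is symmetric as a bilinear form, so being cyclic it must satisfy
    [2 (F x)^2 = 0]; therefore [F = 0] ([dual_mul0_eq0]). *)

Import Order.TTheory GRing.Theory Num.Theory.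
Import numFieldNormedType.Exports.

Local Open Scope ring_scope.

Section DualBounds.
Context {R : realType}.

(** Only the unit ball enters the definition of the dual norm, so the bound is
    obtained by homogeneity from the normalised vector. *)
Lemma dual_norm_bound {V : normedModType R[i]} (F : dual V) (x : V) :
  `|F x| <= `|F| * `|x|.
Proof.
have [->|x0] := eqVneq x 0; first by rewrite linear0 !normr0 mulr0.
have nx0 : 0 < `|x| by rewrite normr_gt0.
rewrite -ler_pdivrMr// mulrC -[X in X * _]ger0_norm ?invr_ge0//.
have -> : `| `|x|^-1 | * `|F x| = `|F (`|x|^-1 *: x)|.
  by rewrite linearZ normrZ.
rewrite complex_normE -[leRHS]/((dual_norm F)%:C%C) lecR.
by apply: dual_norm_ub; rewrite normrZ normfV normr_id mulVf ?gt_eqF.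
Qed.

Lemma norm_dual_lact {A : banachAlgType R[i]} (c : A) (F : dual A) :
  `|dual_lact c F| <= `|c| * `|F|.
Proof.
rewrite (complex_norm_Re c) -[ `|F|]/((dual_norm F)%:C%C).
rewrite -rmorphM -[leLHS]/((dual_norm (dual_lact c F))%:C%C) lecR.
apply: dual_norm_le => x x1.
rewrite -lecR -complex_normE rmorphM mulrC -[leRHS]/(`|F| * (_)%:C%C).
rewrite -complex_norm_Re.
apply: (le_trans (dual_norm_bound F (x * c)%g)).
apply: ler_wpM2l => //; apply: le_trans (banach_normM x c) _.
by rewrite ler_piMl.
Qed.

End DualBounds.

Section LeftAction.
Context {R : realType} {A : banachAlgType R[i]}.
Implicit Types (c : A) (F : dual A) (D : {linear A -> dual A}).

Lemma dual_lact_linear c : linear (dual_lact c : dual A -> dual A).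
Proof. by move=> k F G; apply: dualP. Qed.

HB.instance Definition _ c :=
  GRing.isLinear.Build R[i] (dual A) (dual A) _ (dual_lact c)
    (dual_lact_linear c).

Lemma dual_lact_continuous c : continuous (dual_lact c : dual A -> dual A).
Proof.
apply: bounded_linear_continuous; apply/bounded_funP => r.
exists (`|c| * r) => F Fr.
by apply: le_trans (norm_dual_lact c F) _; rewrite ler_wpM2l.
Qed.

Definition rank_one F (x : A) : dual A := F x *: F.

Lemma rank_one_linear F : linear (rank_one F).
Proof. by move=> k x y; rewrite /rank_one linearP scalerDl scalerA. Qed.

HB.instance Definition _ F :=
  GRing.isLinear.Build R[i] A (dual A) _ (rank_one F)
    (rank_one_linear F).

Lemma rank_one_continuous F : continuous (rank_one F).
Proof. by move=> x; apply: cvgZl; exact: dual_continuous. Qed.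

(** The square of a functional vanishing on products is a derivation for a
    trivial reason, and is cyclic only if it is zero. *)
Lemma dual_mul0_eq0 F :
  cyclically_weakly_amenable A -> (forall a b, F (a * b)%g = 0) -> F = 0.
Proof.
move=> cwA F0; apply: dualP => x.
have := cwA (rank_one F) (rank_one_continuous F) _ x x.
move=> /(_ _)/eqP; rewrite -mulr2n mulrn_eq0/= => sq0.
have : F x * F x = 0.
  apply/eqP/sq0 => a b; apply: dualP => y.
  rewrite -[LHS]/(F (a * b)%g * F y).
  rewrite -[RHS]/(F a * F (b * y)%g + F b * F (y * a)%g).
  by rewrite !F0 mul0r !mulr0 addr0.
by move=> /eqP; rewrite mulf_eq0 orbb => /eqP.
Qed.

Section Commutative.
Hypothesis Acomm : forall a b : A, (a * b)%g = (b * a)%g.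

Lemma dual_ractE F c : dual_ract F c = dual_lact c F.
Proof. by apply: dualP => x /=; rewrite Acomm. Qed.

Lemma inner_eq0 {D} : inner D -> forall a, D a = 0.
Proof. by move=> [F DF] a; rewrite DF dual_ractE subrr. Qed.

(** The left action by [c] commutes with both module actions, the algebra being
    commutative, so it preserves the Leibniz rule. *)
Lemma derivation_lact c {D} : derivation D -> derivation (dual_lact c \o D).
Proof.
move=> dD a b; apply: dualP => x.
rewrite dualDE/= dD dualDE/= !mulgA.
by congr (_ + D b _); rewrite -!mulgA (Acomm c).
Qed.

(** Cyclicity of [c . D] at [(a, b)] says that the Leibniz expansion of
    [<D (a b), c>] vanishes. *)
Lemma derivation_mul_eq0 {D} : cyclically_weakly_amenable A ->
  continuous D -> derivation D -> forall a b, D (a * b)%g = 0.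
Proof.
move=> cwA cD dD a b; apply: dualP => c.
have cD' : continuous (dual_lact c \o D).
  by move=> x; apply: continuous_comp; [exact: cD|exact: dual_lact_continuous].
have := cwA (dual_lact c \o D) cD' (derivation_lact c dD) a b.
by rewrite /= dD dualDE/= (Acomm c).
Qed.

End Commutative.
End LeftAction.

Theorem theorem4p2 (R : realType) (A : banachAlgType R[i])
  (Acomm : forall a b : A, (a * b)%g = (b * a)%g) :
  weakly_amenable A <-> cyclically_weakly_amenable A.
Proof.
split=> [wA D cD dD a b|cwA D cD dD].
  by rewrite !(inner_eq0 Acomm (wA D cD dD)) addr0.
exists 0 => a; rewrite dual_ractE// subrr.
apply: dual_mul0_eq0 => // b c.
have := cwA D cD dD a (b * c)%g.
by rewrite (derivation_mul_eq0 Acomm cwA cD dD) addr0.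
Qed.
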